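(* Let $\mathcal{G}=(\mathcal{N},\mathcal{E})$ be the velocity graph built from $N\geq 2$ ordered waypoints and $M$ sampled velocities per intermediate waypoint. Then the numbers of nodes and edges of $\mathcal{G}$ are $$|\mathcal{N}|=(N-2)M+2,$$ $$|\mathcal{E}|=(N-3)M^2+2M\quad\text{for } N>2.$$
   Context: **Velocity graph.** Let $\boldsymbol{w}_1,\dots,\boldsymbol{w}_N\in\mathbb{R}^3$ be an ordered list of waypoints ($N\ge2$). At each intermediate waypoint $\boldsymbol{w}_i$ ($2\le i\le N-1$) there are $M$ distinct sampled velocities, and each pair (waypoint index, sampled velocity) is a node. At the first waypoint there is exactly one node (the start node) and at the last waypoint exactly one node (the goal node). There is exactly one directed edge from each node at $\boldsymbol{w}_i$ to each node at $\boldsymbol{w}_{i+1}$, for $1\le i\le N-1$, and there are no other edges. (Each edge represents the minimum-time trajectory of an input-constrained double integrator joining the two position-velocity pairs.) *)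

(* Defs.v *)
From HB Require Import structures.
From mathcomp Require Import all_boot all_order all_algebra.
From mathcomp Require Import finmap reals.

Set Implicit Arguments.
Unset Strict Implicit.
Unset Printing Implicit Defensive.

Local Open Scope fset_scope.

(* Edges form a set of ordered pairs, so there is at most one edge from one
   node to another. *)
Record digraph (T : choiceType) := Digraph {
  nodes : {fset T};
  edges : {fset T * T};
  edges_sub : edges `<=` nodes `*` nodes
}.

(* Indices start at 0: the i-th waypoint (1 <= i <= N) has index i - 1 in 'I_N,
   the start has index 0 and the goal has index N - 1. *)
Record sampled_waypoints (R : realType) (N M : nat) := SampledWaypoints {
  waypoints : N.-tuple 'rV[R]_3;
  velocities : 'I_N -> {fset 'rV[R]_3};
  card_start : forall i : 'I_N, i = 0 :> nat -> #|` velocities i| = 1;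
  card_goal : forall i : 'I_N, i = N.-1 :> nat -> #|` velocities i| = 1;
  card_intermediate :
    forall i : 'I_N, 0 < i < N.-1 -> #|` velocities i| = M
}.

Section VelocityGraph.
Variables (R : realType) (N M : nat) (S : sampled_waypoints R N M).

(* A node carries the index of its waypoint and not the position, since
   positions may repeat along the list.  Positions only enter the trajectory
   that an edge stands for. *)
Definition velocity_node : choiceType := ('I_N * 'rV[R]_3)%type.

Definition velocity_nodes : {fset velocity_node} :=
  [fset ((i, v) : velocity_node) | i in 'I_N, v in velocities S i].

Definition velocity_edges : {fset velocity_node * velocity_node} :=
  [fset e in velocity_nodes `*` velocity_nodes | e.2.1 == e.1.1.+1 :> nat].

Lemma velocity_edges_sub :
  velocity_edges `<=` velocity_nodes `*` velocity_nodes.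
Proof. exact: fset_sub. Qed.

Definition velocity_graph : digraph velocity_node :=
  Digraph velocity_edges_sub.

End VelocityGraph.

(* Main.v *)
Require Import Defs.
From mathcomp Require Import all_boot all_order all_algebra.
From mathcomp Require Import finmap reals.

Set Implicit Arguments.
Unset Strict Implicit.
Unset Printing Implicit Defensive.

Local Open Scope fset_scope.

(** The graph is layered by waypoint index: the end layers have one node each, the others [M]. Nodes
    are counted layer by layer ([card_velocity_nodes]). Edges are grouped by source index; those
    leaving layer [i] form the full product of layers [i] and [i.+1] ([card_velocity_edges]). For
    [N > 2] the first and last transitions are distinct and contribute [M] edges each, and each of
    the [N - 3] transitions between them contributes [M ^ 2]. *)

Lemma card_fset_fibers (T : choiceType) (A : {fset T}) (f : T -> nat) (k : nat) :
    (forall x, x \in A -> f x < k) ->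
  #|` A| = \sum_(i < k) #|` [fset x in A | f x == i]|.
Proof.
move=> f_lt; rewrite card_fset_sum1.
(* Double counting: fibre sizes become sums of indicators, and after exchanging the sums each [x] is
   counted once, at the index [f x]. *)
under [RHS]eq_bigr => i _ do rewrite card_fset_sum1 big_fset big_mkcond.
rewrite /= exchange_big /=; apply: eq_big_seq => x xA.
rewrite -big_mkcond /= (big_pred1 (Ordinal (f_lt x xA))) //.
Qed.

Lemma card_fsetM (K K' : choiceType) (A : {fset K}) (B : {fset K'}) :
  #|` A `*` B| = #|` A| * #|` B|.
Proof.
rewrite card_fset_sum1 big_imfset2 /=; last by move=> [? ?] [? ?] _ _ [-> ->].
under eq_bigr => x _ do rewrite -card_fset_sum1.
by rewrite big_const_seq count_predT iter_addn_0 mulnC.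
Qed.

Section Layers.
Variables (R : realType) (n M : nat) (S : sampled_waypoints R n.+2 M).

(** Indexed by [nat] rather than ['I_n.+2], so that [layer i.+1] needs no bound proof. *)
Definition layer (i : nat) : {fset velocity_node R n.+2} :=
  [fset x in velocity_nodes S | x.1 == i :> nat].

Lemma card_layer (i : 'I_n.+2) : #|` layer i| = #|` velocities S i|.
Proof.
have -> : layer i = [fset ((i, v) : velocity_node R n.+2) | v in velocities S i].
  apply/fsetP => -[j v]; rewrite !inE /=; apply/andP/imfsetP => /=.
    case=> /imfset2P[k _ [u uk [-> ->]]] /eqP/val_inj ki.
    by exists u; rewrite -?ki.
  case=> u ui [-> ->]; split=> //.
  by apply/imfset2P; exists i => //; exists u.
by rewrite card_imfset //= => u v [].
Qed.

Lemma card_layer_start : #|` layer 0| = 1.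
Proof. by rewrite (card_layer ord0) card_start. Qed.

Lemma card_layer_goal : #|` layer n.+1| = 1.
Proof. by rewrite (card_layer ord_max) card_goal. Qed.

Lemma card_layer_intermediate (i : nat) : i < n -> #|` layer i.+1| = M.
Proof.
move=> lt_in; have lt_i : i.+1 < n.+2 by rewrite ltnS ltnW.
by rewrite (card_layer (Ordinal lt_i)) card_intermediate.
Qed.

Lemma card_velocity_nodes :
  #|` velocity_nodes S| = \sum_(i < n.+2) #|` layer i|.
Proof.
by apply: (card_fset_fibers (f := fun x : velocity_node R n.+2 => x.1)) => x _.
Qed.

Lemma card_velocity_edges :
  #|` velocity_edges S| = \sum_(i < n.+1) #|` layer i| * #|` layer i.+1|.
Proof.
pose f (e : velocity_node R n.+2 * velocity_node R n.+2) : nat := e.1.1.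
rewrite (@card_fset_fibers _ _ f n.+1); last first.
  move=> [x y]; rewrite !inE /= => /andP[_ /eqP xy].
  (* A source index is below [n.+1], since its successor is the index of the target. *)
  by rewrite -ltnS -xy ltn_ord.
apply: eq_bigr => i _; rewrite -card_fsetM; congr #|` _|.
apply/fsetP => -[x y]; rewrite !inE /f /=.
(* Once the source index is [i], the edge condition says that [y] lies in layer [i.+1]; otherwise
   both sides are false. *)
have [->|_] := eqVneq (x.1 : nat) i; last by rewrite !andbF.
by rewrite !andbT andbA.
Qed.

End Layers.

Local Close Scope fset_scope.

Theorem proposition1 (R : realType) (N M : nat) (hN : 2 <= N)
    (S : sampled_waypoints R N M) :
  #|` nodes (velocity_graph S)|%fset = (N - 2) * M + 2 /\
  (2 < N -> #|` edges (velocity_graph S)|%fset = (N - 3) * M ^ 2 + 2 * M).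
Proof.
case: N hN S => [|[|n]] // _ S; rewrite /= !subSS subn0; split=> [|n_gt0].
  rewrite card_velocity_nodes big_ord_recl big_ord_recr /=.
  rewrite card_layer_start card_layer_goal.
  under eq_bigr => i _ do rewrite card_layer_intermediate //.
  by rewrite sum_nat_const card_ord addnCA.
(* Now [N] is [n.+3]: of the [n.+2] transitions, the two extreme ones are split off and [n]
   remain. *)
case: n n_gt0 S => // n _ S; rewrite subSS subn0.
rewrite card_velocity_edges big_ord_recl big_ord_recr /=.
rewrite card_layer_start card_layer_goal !card_layer_intermediate //.
under eq_bigr => i _.
  rewrite /bump /= add1n !card_layer_intermediate // ?ltnS ?(ltnW (ltn_ord i)) //.
  over.
by rewrite sum_nat_const card_ord mul1n muln1 addnCA -mulnn mul2n addnn.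
Qed.
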